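(* Let $\mathrm T$ be a strict Archimedean $t$-norm with additive generator $\mathrm t$ and let $\mathrm S$ be a strict Archimedean $t$-conorm with additive generator $\mathrm s$. Set $\widehat{\mathrm t}=\mathrm t|_{(0,1)}$ and $\widehat{\mathrm s}=\mathrm s|_{(0,1)}$. Then the pair $(\mathrm T|_{\mathsf{Int}_{[0,1]}},\mathrm S|_{\mathsf{Int}_{[0,1]}})$ is admissible if and only if $\widehat{\mathrm s}\circ\widehat{\mathrm t}^{-1}$ is strictly convex or strictly concave.
   Context: Let $\mathsf{Int}_{[0,1]}=\{[a_1,a_2]: 0\le a_1\le a_2\le 1\}$ (degenerate intervals allowed); write $\mathbf u=[u_1,u_2]$. The interval order is: $\mathbf u\preceq_{\mathrm{Int}}\mathbf x$ iff $u_1\le x_1$ and $u_2\le x_2$. An admissible order is a total order $\preceq$ on $\mathsf{Int}_{[0,1]}$ such that $\mathbf u\preceq_{\mathrm{Int}}\mathbf x$ implies $\mathbf u\preceq\mathbf x$. An aggregation function (AF) is a function $\mathrm A\colon\mathsf{Int}_{[0,1]}\to[0,1]$ with $\mathrm A([0,0])=0$, $\mathrm A([1,1])=1$, and $\mathrm A(\mathbf u)\le\mathrm A(\mathbf x)$ whenever $u_1\le x_1$ and $u_2\le x_2$. For a pair $(\mathrm A,\mathrm B)$ of AFs, the relation $\preceq_{\mathrm A,\mathrm B}$ is defined by: $\mathbf u\preceq_{\mathrm A,\mathrm B}\mathbf x$ iff $\mathrm A(\mathbf u)<\mathrm A(\mathbf x)$, or $\mathrm A(\mathbf u)=\mathrm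 A(\mathbf x)$ and $\mathrm B(\mathbf u)\le\mathrm B(\mathbf x)$. The pair $(\mathrm A,\mathrm B)$ is admissible if $\preceq_{\mathrm A,\mathrm B}$ is an admissible order. For $\mathrm F\colon[0,1]^2\to[0,1]$, the restriction $\mathrm F|_{\mathsf{Int}_{[0,1]}}$ is the function $[x_1,x_2]\mapsto\mathrm F(x_1,x_2)$. A $t$-norm $\mathrm T\colon[0,1]^2\to[0,1]$ (commutative, associative, increasing in each argument, with neutral element $1$) is Archimedean if it is continuous and $\mathrm T(x,x)<x$ for all $x\in(0,1)$. Archimedean $t$-norms are exactly the functions $\mathrm T(a,b)=\mathrm t^{-1}\big(\min\{\mathrm t(a)+\mathrm t(b),\mathrm t(0)\}\big)$, where the additive generator $\mathrm t\colon[0,1]\to[0,\infty]$ is continuous and strictly decreasing with $\mathrm t(1)=0$; $\mathrm T$ is strict if $\mathrm t(0)=\infty$ and nilpotent if $\mathrm t(0)<\infty$. A $t$-conorm $\mathrm S\colon[0,1]^2\to[0,1]$ (commutative, associative, increasing in each argument, with neutral element $0$) is Archimedean if it is continuous and $\mathrm S(x,x)>x$ for all $x\in(0,1)$. Archimedean $t$-conorms are represented as $\mathrm S(a,b)=\mathrm s^{-1}\big(\min\{\mathrm s(a)+\mathrm s(b),\mathrm s(1)\}\big)$, where the additive generator $\mathrm s\colon[0,1]\to[0,\infty]$ is continuous and strictly increasing with $\mathrm s(0)=0$; $\mathrm S$ is strict if $\mathrm s(1)=\infty$ and nilpotent if $\mathrm s(1)<\infty$. *)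

(* Defs.v *)
From HB Require Import structures.
From mathcomp Require Export all_boot all_order all_algebra.
From mathcomp Require Export all_classical all_reals all_analysis.
From mathcomp Require Import wochoice.
Export numFieldNormedType.Exports.

Set Implicit Arguments.
Unset Strict Implicit.
Unset Printing Implicit Defensive.

Import Order.TTheory GRing.Theory Num.Theory.
Local Open Scope classical_set_scope.
Local Open Scope ring_scope.

(* Real functions on [0,1] or [0,1]^2 are functions on R whose values outside
   the unit interval (square) are never constrained nor used. *)

Section Intervals.
Variable R : realType.

Record Int01 := MkInt01 {
  lo : R;
  hi : R;
  Int01P : [&& 0 <= lo, lo <= hi & hi <= 1] }.

Lemma int00_subproof : [&& 0 <= (0 : R), (0 : R) <= 0 & (0 : R) <= 1].
Proof. by rewrite lexx ler01. Qed.

Lemma int11_subproof : [&& 0 <= (1 : R), (1 : R) <= 1 & (1 : R) <= 1].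
Proof. by rewrite lexx ler01. Qed.

Definition int00 : Int01 := MkInt01 int00_subproof.
Definition int11 : Int01 := MkInt01 int11_subproof.

Definition le_Int (u x : Int01) : bool := (lo u <= lo x) && (hi u <= hi x).

Definition admissible_order (r : rel Int01) : Prop :=
  total_order r /\ forall u x, le_Int u x -> r u x.

Definition aggregation_function (A : Int01 -> R) : Prop :=
  [/\ forall u, A u \in `[0, 1],
      A int00 = 0,
      A int11 = 1 &
      forall u x, lo u <= lo x -> hi u <= hi x -> A u <= A x].

Definition le_pair (A B : Int01 -> R) : rel Int01 := fun u x =>
  (A u < A x) || ((A u == A x) && (B u <= B x)).

Definition admissible_pair (A B : Int01 -> R) : Prop :=
  [/\ aggregation_function A, aggregation_function B &
      admissible_order (le_pair A B)].

Definition restrict_Int (F : R -> R -> R) : Int01 -> R :=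
  fun x => F (lo x) (hi x).

End Intervals.

Section Norms.
Variable R : realType.
Implicit Types (T S : R -> R -> R) (t s : R -> \bar R).

Definition unit_square_operation (F : R -> R -> R) : Prop :=
  [/\ {in `[0, 1] &, forall a b, F a b \in `[0, 1]},
      {in `[0, 1] &, forall a b, F a b = F b a},
      {in `[0, 1] & &, forall a b c, F a (F b c) = F (F a b) c},
      {in `[0, 1] & &, forall a b c, a <= b -> F a c <= F b c} &
      {in `[0, 1] & &, forall a b c, a <= b -> F c a <= F c b}].

Definition tnorm T : Prop :=
  unit_square_operation T /\ {in `[0, 1], forall a, T a 1 = a}.

Definition tconorm S : Prop :=
  unit_square_operation S /\ {in `[0, 1], forall a, S a 0 = a}.

Definition continuous_on_square (F : R -> R -> R) : Prop :=
  {within [set` `[0, 1]] `*` [set` `[0, 1]],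
    continuous (fun p : R * R => F p.1 p.2)}.

Definition archimedean_tnorm T : Prop :=
  [/\ tnorm T, continuous_on_square T &
      {in `]0, 1[, forall x, T x x < x}].

Definition archimedean_tconorm S : Prop :=
  [/\ tconorm S, continuous_on_square S &
      {in `]0, 1[, forall x, x < S x x}].

(* [pinv A f] is the inverse of [f] restricted to [A]; the generators below are
   injective on [0,1], and the truncated sum lies in their range. *)
Definition tnorm_generator T t : Prop :=
  [/\ {in `[0, 1], forall x, (0 <= t x)%E},
      {within `[0, 1], continuous t},
      {in `[0, 1] &, forall x y, x < y -> (t y < t x)%E},
      t 1 = 0%E &
      {in `[0, 1] &, forall a b,
        T a b = pinv (`[0, 1] : set R) t (Order.min (t a + t b)%E (t 0))}].

Definition tconorm_generator S s : Prop :=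
  [/\ {in `[0, 1], forall x, (0 <= s x)%E},
      {within `[0, 1], continuous s},
      {in `[0, 1] &, forall x y, x < y -> (s x < s y)%E},
      s 0 = 0%E &
      {in `[0, 1] &, forall a b,
        S a b = pinv (`[0, 1] : set R) s (Order.min (s a + s b)%E (s 1))}].

Definition strict_tnorm T t : Prop :=
  [/\ archimedean_tnorm T, tnorm_generator T t & t 0 = +oo%E].

Definition strict_tconorm S s : Prop :=
  [/\ archimedean_tconorm S, tconorm_generator S s & s 1 = +oo%E].

(* A generator is finite on ]0,1[, so that its restriction to ]0,1[ is the
   real-valued function [fine \o t]. When [t 0 = +oo] this restriction maps
   ]0,1[ onto ]0,+oo[, which is thus the domain of the composition below. *)
Definition generator_comp s t : R -> R :=
  (fine \o s) \o pinv (`]0, 1[ : set R) (fine \o t).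

Definition strictly_convex_on (D : set R) (f : R -> R) : Prop :=
  forall x y l, D x -> D y -> x != y -> 0 < l < 1 ->
    f (l * x + (1 - l) * y) < l * f x + (1 - l) * f y.

Definition strictly_concave_on (D : set R) (f : R -> R) : Prop :=
  forall x y l, D x -> D y -> x != y -> 0 < l < 1 ->
    l * f x + (1 - l) * f y < f (l * x + (1 - l) * y).

End Norms.

(* Main.v *)
(* Put [phi = s \o t^-1], a continuous decreasing bijection of ]0, +oo[. Only
   antisymmetry of the lexicographic relation is at stake: it says that (T, S)
   is injective on intervals. Intervals with an endpoint 0 or 1 are always
   separated, and in the coordinates [p = t u_1 >= q = t u_2] injectivity on the
   remaining ones says that [p + q] and [phi p + phi q] determine [(p, q)].
   Strict convexity or concavity gives this by majorization. Conversely,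
   comparing [p, q] with the degenerate interval of the same sum shows that
   [phi p + phi q - 2 phi ((p + q) / 2)] does not vanish for [p <> q]; by the
   intermediate value theorem it has constant sign, so that [phi] or [- phi] is
   strictly midpoint convex, hence strictly convex by continuity. *)
Require Import Defs.
From mathcomp Require Import ring lra.
Import Order.TTheory GRing.Theory Num.Theory.
Local Open Scope classical_set_scope.
Local Open Scope ring_scope.

Set Implicit Arguments.
Unset Strict Implicit.
Unset Printing Implicit Defensive.

(** * Strict convexity, majorization and midpoint convexity *)

Section Convexity.
Variable R : realType.
Implicit Types (D : set R) (f : R -> R).

Lemma strictly_convex_onN D f :
  strictly_convex_on D (\- f) <-> strictly_concave_on D f.
Proof.
by split=> fD x y l Dx Dy xy l01; have := fD x y l Dx Dy xy l01;
  rewrite /= !mulrN -opprD ltrN2.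
Qed.

(** Both [p] and [q] are convex combinations of [p'] and [q'], with the weights [l] and [1 - l]
    exchanged. Adding the two strict convexity inequalities makes the weights cancel. *)
Lemma strictly_convex_on_majorized D f p q p' q' : strictly_convex_on D f ->
  D p' -> D q' -> q' < q <= p -> p + q = p' + q' -> f p + f q < f p' + f q'.
Proof.
move=> fD Dp' Dq' /andP[q'q qp] pq.
have pp' : p < p' by lra.
pose l := (p - q') / (p' - q').
have d0 : p' - q' != 0 by lra.
have l01 : 0 < l < 1 by rewrite divr_gt0 ?ltr_pdivrMr; lra.
have np : p' != q' by lra.
have nq : q' != p' by lra.
have lp : l * p' + (1 - l) * q' = p by rewrite /l; field.
clearbody l.
have lq : l * q' + (1 - l) * p' = q by lra.
have := fD p' q' l Dp' Dq' np l01; have := fD q' p' l Dq' Dp' nq l01.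
by rewrite lp lq; lra.
Qed.

(** Of two distinct ordered pairs with the same sum, one lies strictly inside the other, so
    majorization separates the sums of values. The concave case is the convex one for [\- f]. *)
Lemma majorized_sum_inj D f p q p' q' :
  strictly_convex_on D f \/ strictly_concave_on D f ->
  D p -> D q -> D p' -> D q' -> q <= p -> q' <= p' ->
  p + q = p' + q' -> f p + f q = f p' + f q' -> p = p'.
Proof.
wlog fD : f / strictly_convex_on D f => [wl [fD|/strictly_convex_onN fD]|_].
- by apply: wl => //; left.
- move=> Dp Dq Dp' Dq' qp qp' pq fpq; apply: (wl (\- f)) => //; first by left.
  by rewrite /= -!opprD fpq.
move=> Dp Dq Dp' Dq' qp qp' pq fpq; have [pp'|p'p|//] := ltgtP p p'.
  have qs : q' < q <= p by lra.
  by have := strictly_convex_on_majorized fD Dp' Dq' qs pq; rewrite fpq ltxx.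
have qs : q < q' <= p' by lra.
by have := strictly_convex_on_majorized fD Dp Dq qs (esym pq); rewrite fpq ltxx.
Qed.

Lemma midpoint_strictly_convex_on D f : is_interval D -> {in D, continuous f} ->
  (forall a b, D a -> D b -> a < b -> 2 * f ((a + b) / 2) < f a + f b) ->
  strictly_convex_on D f.
Proof.
move=> Di fc mid x y l; wlog xy : x y l / x < y => [wl Dx Dy|].
  move=> nxy l01; have [xy|yx|/eqP] := ltgtP x y; last by rewrite (negPf nxy).
    exact: wl.
  have := wl y x (1 - l) yx Dy Dx; rewrite (lt_eqF yx).
  have -> : 1 - (1 - l) = l by lra.
  by rewrite [l * x + _]addrC [l * f x + _]addrC; apply => //; lra.
move=> Dx Dy _ l01; rewrite ltNge; apply/negP => chord.
(* At an interior maximum [c] of [f] minus its chord, midpoint convexity fails. *)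
pose k := (f y - f x) / (y - x).
pose g z := f z - k * z.
have Dxy z : x <= z <= y -> D z by exact: Di.
have gc : {within `[x, y], continuous g}.
  apply: continuous_in_subspaceT => z /set_mem; rewrite /= in_itv /= => /Dxy Dz.
  apply: cvgB; first by apply: fc; exact/mem_set.
  exact: mulrl_continuous.
have gxy : g y = g x by rewrite /g /k; field; lra.
(* At [m] strict convexity is assumed to fail, so [g m] is at least the common value of [g] at [x]
   and [y]. *)
pose m := l * x + (1 - l) * y.
have mx : x < m < y by rewrite /m; nra.
have gm : g x <= g m.
  have -> : g x = l * f x + (1 - l) * f y - k * m by rewrite /m /g /k; field; lra.
  by rewrite /g; lra.
have [c [cxy cmax]] : exists c, x < c < y /\ forall z, x <= z <= y -> g z <= g c.
  have [c] := EVT_max (ltW xy) gc; rewrite in_itv /= => /andP[xc cy] cmax.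
  have {}cmax z : x <= z <= y -> g z <= g c by move=> ?; apply: cmax; rewrite in_itv.
  (* If the maximum is attained at an endpoint, then it is attained at the interior point [m] as
     well. *)
  have gmc : g c <= g x -> forall z, x <= z <= y -> g z <= g m.
    by move=> cx z /cmax; lra.
  have [ex|nx] := eqVneq c x.
    by exists m; split=> //; apply: gmc; rewrite ex.
  have [ey|ny] := eqVneq c y.
    by exists m; split=> //; apply: gmc; rewrite ey gxy.
  by exists c; split=> //; rewrite !lt_neqAle xc cy eq_sym nx ny.
(* The largest radius that keeps [c - d] and [c + d] in the segment; it is positive because [c] is
   interior. *)
pose d := Num.min (c - x) (y - c).
have d0 : 0 < d by rewrite lt_min; lra.
have [dx dy] : d <= c - x /\ d <= y - c by rewrite !ge_min !lexx orbT.
have ab : c - d < c + d by lra.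
have := mid (c - d) (c + d) _ _ ab; have -> : (c - d + (c + d)) / 2 = c by lra.
have := cmax (c - d); have := cmax (c + d); rewrite /g => h1 h2 h3.
have : 2 * f c < f (c - d) + f (c + d) by apply: h3; apply: Dxy; lra.
have {}h1 := h1 ltac:(lra); have {}h2 := h2 ltac:(lra); lra.
Qed.

Lemma midpoint_convex_or_concave D f : is_interval D -> {in D, continuous f} ->
  (forall a b, D a -> D b -> a < b -> f a + f b != 2 * f ((a + b) / 2)) ->
  strictly_convex_on D f \/ strictly_concave_on D f.
Proof.
move=> Di fc ne.
pose h a b := f a + f b - 2 * f ((a + b) / 2).
have h0 a b : D a -> D b -> a < b -> h a b != 0.
  by move=> Da Db ab; rewrite subr_eq0 ne.
have [neg|] := pselect (exists a b, [/\ D a, D b, a < b & h a b < 0]); last first.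
  move=> npos; left; apply: midpoint_strictly_convex_on => // a b Da Db ab.
  rewrite -subr_gt0 lt_neqAle eq_sym h0 //= leNgt.
  by apply/negP => hab; apply: npos; exists a, b.
right; apply/strictly_convex_onN; apply: midpoint_strictly_convex_on => //.
  by move=> z Dz; apply: cvgN; exact: fc.
move=> a b Da Db ab; rewrite /= mulrN -opprD ltrN2 -subr_lt0.
rewrite lt_neqAle h0 //= leNgt; apply/negP => hab.
have [a' [b' [Da' Db' ab' hab']]] := neg.
(* The sign of [h] changes along the segment from [(a, b)] to [(a', b')]. *)
pose u r : R := a + r * (a' - a); pose v r : R := b + r * (b' - b).
have affc (p q : R) : continuous (fun r : R => p + r * q).
  by move=> r; apply: cvgD; [exact: cvg_cst|exact: mulrr_continuous].
have Dconv p q r : D p -> D q -> 0 <= r <= 1 -> D (p + r * (q - p)).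
  move=> Dp Dq r01; have [pq|qp] := leP p q.
    by apply: (Di p q) => //; nra.
  by apply: (Di q p) => //; nra.
have hc : {within `[0, 1], continuous (fun r => h (u r) (v r))}.
  apply: continuous_in_subspaceT => r /set_mem; rewrite /= in_itv /= => r01.
  have fcomp (p q : R) : D (p + r * q) -> f (p + z * q) @[z --> r] --> f (p + r * q).
    move=> Dr; apply: (@continuous_comp _ _ _ (fun z : R => p + z * q) f).
      exact: affc.
    by apply: fc; exact/mem_set.
  apply: cvgB; first by apply: cvgD; apply: fcomp; apply: Dconv.
  apply: cvgMr.
  rewrite /u /v.
  (* The midpoint of [u r] and [v r] is itself affine in [r], so [fcomp] covers this term too. *)
  have E : (fun r : R => f ((a + r * (a' - a) + (b + r * (b' - b))) / 2)) =
    (fun r => f ((a + b) / 2 + r * ((a' + b') / 2 - (a + b) / 2))).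
    by apply/funext => z; congr f; field.
  rewrite E.
  have -> : (u r + v r) / 2 = (a + b) / 2 + r * ((a' + b') / 2 - (a + b) / 2).
    by rewrite /u /v; field.
  apply: fcomp; apply: Dconv => //.
    by apply: (Di a b) => //; lra.
  by apply: (Di a' b') => //; lra.
have [|r] := IVT ler01 hc (v := 0).
  have [-> ->] : u 0 = a /\ v 0 = b by rewrite /u /v !mul0r !addr0.
  have [-> ->] : u 1 = a' /\ v 1 = b' by rewrite /u /v !mul1r !subrKC.
  by rewrite ge_min le_max (ltW hab') (ltW hab) orbT.
rewrite in_itv /= => r01; apply/eqP; apply: h0; [exact: Dconv|exact: Dconv|].
(* The gap is [(1 - r) * (b - a) + r * (b' - a')]: its first term is positive for [r < 1], its
   second for [r = 1]. *)
rewrite /u /v; have [r1|r1] := ltP r 1; nra.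
Qed.
End Convexity.

(** * The intermediate value theorem for extended real functions *)

Lemma contract_continuous (R : realType) : continuous (@contract R).
Proof.
(* Distances in [\bar R] are by definition distances between images under [contract]. *)
move=> x; apply/cvg_ballP => e e0; near=> y.
near: y; exact: (nbhsx_ballx x e e0).
Unshelve. all: by end_near. Qed.

(** The real theorem applies to [contract \o f], and [contract] is increasing and injective. *)
Lemma IVT_ereal (R : realType) (f : R -> \bar R) (a b : R) (v : \bar R) :
  a <= b -> {within `[a, b], continuous f} ->
  (Order.min (f a) (f b) <= v <= Order.max (f a) (f b))%E ->
  exists2 c, c \in `[a, b] & f c = v.
Proof.
move=> ab fc fv.
have cfc : {within `[a, b], continuous (@contract R \o f)}.
  by apply: within_continuous_comp => // x _; exact: contract_continuous.
have [|c cab fcv] := IVT ab cfc (v := contract v).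
  by rewrite ge_min le_max /= !le_contract -ge_min -le_max.
by exists c => //; exact: contract_inj fcv.
Qed.

(** * Strict generators, for t-norms and t-conorms alike *)

Section StrictGenerator.
Variable R : realType.
Implicit Types (F : R -> R -> R) (g : R -> \bar R).

(* [o] is the neutral element and [e] the annihilator of [F], so that strict
   t-norms ([o = 1], [e = 0]) and strict t-conorms ([o = 0], [e = 1]) are both
   covered. *)
Definition strict_generator F g (o e : R) : Prop :=
  [/\ (o = 0 /\ e = 1) \/ (o = 1 /\ e = 0),
      g o = 0%E /\ g e = +oo%E,
      {in `[0, 1] &, injective g},
      forall v, (0 <= v)%E <-> exists2 x, x \in `[0, 1] & g x = v &
      {in `[0, 1] &, forall a b,
        F a b \in `[0, 1] /\ g (F a b) = (g a + g b)%E}].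

Lemma in01_0 : (0 : R) \in `[0, 1]. Proof. by rewrite in_itv /= lexx ler01. Qed.

Lemma in01_1 : (1 : R) \in `[0, 1]. Proof. by rewrite in_itv /= lexx ler01. Qed.

(** The endpoint values 0 and [+oo] make [g] onto the nonnegative extended reals. As [g e] is
    infinite, the truncation by [Order.min] has no effect and [pinv] is a genuine inverse at the
    sum. *)
Lemma strict_generator_intro F g o e :
  (o = 0 /\ e = 1) \/ (o = 1 /\ e = 0) -> g o = 0%E -> g e = +oo%E ->
  {in `[0, 1] &, injective g} -> {in `[0, 1], forall x, (0 <= g x)%E} ->
  {within `[0, 1], continuous g} ->
  {in `[0, 1] &, forall a b, F a b \in `[0, 1]} ->
  {in `[0, 1] &, forall a b,
    F a b = pinv (`[0, 1] : set R) g (Order.min (g a + g b)%E (g e))} ->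
  strict_generator F g o e.
Proof.
move=> oe go ge ginj g0 gc F01 FE.
have gsurj v : (0 <= v)%E <-> exists2 x, x \in `[0, 1] & g x = v.
  split=> [v0|[x x01 <-]]; last exact: g0.
  apply: (@IVT_ereal R g 0 1 v ler01 gc).
  by case: oe => -[<- <-]; rewrite go ge ge_min le_max v0 leey ?orbT.
split=> // a b a01 b01; split; first exact: F01.
rewrite FE // ge min_l ?leey // pinvK //; apply/mem_set.
by have /gsurj[x x01 gx] := adde_ge0 (g0 _ a01) (g0 _ b01); exists x.
Qed.

Lemma strict_tnorm_generator T t : strict_tnorm T t -> strict_generator T t 1 0.
Proof.
case=> -[[[T01 _ _ _ _] _] _ _] [t0 tc tdec t1 TE] too.
apply: strict_generator_intro => //; first by right.
move=> x y x01 y01 txy; have [xy|yx|//] := ltgtP x y.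
  by have := tdec _ _ x01 y01 xy; rewrite txy ltxx.
by have := tdec _ _ y01 x01 yx; rewrite txy ltxx.
Qed.

Lemma strict_tconorm_generator S s :
  strict_tconorm S s -> strict_generator S s 0 1.
Proof.
case=> -[[[S01 _ _ _ _] _] _ _] [s0 sc sinc s1 SE] soo.
apply: strict_generator_intro => //; first by left.
move=> x y x01 y01 sxy; have [xy|yx|//] := ltgtP x y.
  by have := sinc _ _ x01 y01 xy; rewrite sxy ltxx.
by have := sinc _ _ y01 x01 yx; rewrite sxy ltxx.
Qed.

Section Theory.
Variables (F : R -> R -> R) (g : R -> \bar R) (o e : R).
Hypothesis Fg : strict_generator F g o e.

Lemma strict_generator_inj : {in `[0, 1] &, injective g}.
Proof. by case: Fg. Qed.

Lemma strict_generator_eq a b c d :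
  a \in `[0, 1] -> b \in `[0, 1] -> c \in `[0, 1] -> d \in `[0, 1] ->
  F a b = F c d <-> (g a + g b = g c + g d)%E.
Proof.
case: Fg => _ _ ginj _ FE a01 b01 c01 d01.
have [[Fab01 gab] [Fcd01 gcd]] := (FE _ _ a01 b01, FE _ _ c01 d01).
rewrite -gab -gcd; split=> [->//|]; exact: ginj.
Qed.

Lemma strict_generator_bounds01 : o \in `[0, 1] /\ e \in `[0, 1].
Proof. by case: Fg => -[[-> ->]|[-> ->]] *; rewrite in01_0 in01_1. Qed.

Lemma strict_generator_pinfty x : x \in `[0, 1] -> g x = +oo%E -> x = e.
Proof.
case: Fg => _ [_ ge] ginj _ _ x01 gx.
by apply: ginj => //; [case: strict_generator_bounds01|rewrite ge].
Qed.

Lemma strict_generator_ge0 x : x \in `[0, 1] -> (0 <= g x)%E.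
Proof. by case: Fg => _ _ _ gv _ x01; apply/gv; exists x. Qed.

Lemma strict_generator_fin x : x \in `[0, 1] -> x != e -> (fine (g x))%:E = g x.
Proof.
move=> x01 xe; have := strict_generator_ge0 x01.
case gx : (g x) => [r||] //= _.
by case/eqP: xe; exact: strict_generator_pinfty.
Qed.

Lemma strict_generator_addy x y : x \in `[0, 1] -> y \in `[0, 1] ->
  (g x + g y)%E = +oo%E <-> x = e \/ y = e.
Proof.
move=> x01 y01; case: (Fg) => _ [_ ge] _ _ _; split.
  have [->|xe] := eqVneq x e; first by left.
  have [->|ye] := eqVneq y e; first by right.
  by rewrite -(strict_generator_fin x01 xe) -(strict_generator_fin y01 ye).
(* The sum of [+oo] and [-oo] is [-oo], so the value [-oo] has to be excluded. *)
have gNy z : z \in `[0, 1] -> g z != -oo%E.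
  by move=> /strict_generator_ge0; case: (g z).
by case=> ->; rewrite ge ?addye ?addey // gNy.
Qed.

Lemma in01_oo x : (x \in `]0, 1[) = [&& x \in `[0, 1], x != o & x != e].
Proof.
have -> : (x \in `]0, 1[) = [&& x \in `[0, 1], x != 0 & x != 1].
  rewrite !in_itv /= !lt_neqAle eq_sym.
  by case: (x == 0); case: (x == 1); rewrite /= ?andbF ?andbT.
by case: Fg => -[[-> ->]|[-> ->]] _ _ _ _; rewrite // [X in _ && X]andbC.
Qed.

Lemma strict_generator_gt0 x : x \in `]0, 1[ ->
  (fine (g x))%:E = g x /\ 0 < fine (g x).
Proof.
rewrite in01_oo => /and3P[x01 xo xe]; have gE := strict_generator_fin x01 xe.
split=> //; rewrite -lte_fin gE lt_neqAle strict_generator_ge0 // andbT.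
case: Fg => _ [go _] ginj _ _; apply/eqP => gx; case/eqP: xo.
by apply: ginj => //; [case: strict_generator_bounds01|rewrite go].
Qed.

Lemma strict_generator_surj (r : R) : 0 < r ->
  exists2 x, x \in `]0, 1[ & fine (g x) = r.
Proof.
move=> r0; case: Fg => _ [go ge] _ gv _.
have /gv[x x01 gx] : (0 <= r%:E)%E by rewrite lee_fin ltW.
exists x; last by rewrite gx.
rewrite in01_oo x01 /=; apply/andP; split; apply/eqP => xE; move: gx.
  by rewrite xE go => -[rE]; rewrite -rE ltxx in r0.
by rewrite xE ge.
Qed.

End Theory.
End StrictGenerator.

(** * The map [phi] from one generator to the other *)

Section Main.
Variables (R : realType) (T S : R -> R -> R) (t s : R -> \bar R).
Hypotheses (hT : strict_tnorm T t) (hS : strict_tconorm S s).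

Let gT : strict_generator T t 1 0 := strict_tnorm_generator hT.
Let gS : strict_generator S s 0 1 := strict_tconorm_generator hS.
Let phi : R -> R := generator_comp s t.

Lemma subset_itv01 (x : R) : x \in `]0, 1[ -> x \in `[0, 1].
Proof. by rewrite (in01_oo gT) => /and3P[]. Qed.

(** Every positive real is some [t x], so claims on [phi] become claims on [s] and [t] at the same
    point. *)
Lemma generator_compE x : x \in `]0, 1[ -> phi (fine (t x)) = fine (s x).
Proof.
move=> x01; rewrite /phi /generator_comp /=.
suff : {in ([set` `]0, 1[] : set R) &, injective (fine \o t)}.
  by move=> inj; rewrite -[fine (t x)]/((fine \o t) x) pinvKV //; exact/mem_set.
move=> a b /set_mem a01 /set_mem b01 /= tab.
apply: (strict_generator_inj gT); [exact: subset_itv01|exact: subset_itv01|].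
by case: (strict_generator_gt0 gT a01) => <- _;
  case: (strict_generator_gt0 gT b01) => <- _; rewrite tab.
Qed.

Lemma tnorm_generator_decreasing x y : x \in `]0, 1[ -> y \in `]0, 1[ ->
  (fine (t x) < fine (t y)) = (y < x).
Proof.
case: hT => _ [_ _ tdec _ _] _.
have mono a b : a \in `]0, 1[ -> b \in `]0, 1[ -> a < b -> fine (t b) < fine (t a).
  move=> a01 b01 ab; rewrite -lte_fin.
  case: (strict_generator_gt0 gT a01) => -> _.
  case: (strict_generator_gt0 gT b01) => -> _.
  by apply: tdec => //; exact: subset_itv01.
move=> x01 y01; have [yx|xy|->] := ltgtP y x; last by rewrite ltxx.
  exact: mono.
by apply/negbTE; rewrite -leNgt ltW // mono.
Qed.

Lemma tconorm_generator_increasing x y : x \in `]0, 1[ -> y \in `]0, 1[ ->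
  (fine (s x) < fine (s y)) = (x < y).
Proof.
case: hS => _ [_ _ sinc _ _] _.
have mono a b : a \in `]0, 1[ -> b \in `]0, 1[ -> a < b -> fine (s a) < fine (s b).
  move=> a01 b01 ab; rewrite -lte_fin.
  case: (strict_generator_gt0 gS a01) => -> _.
  case: (strict_generator_gt0 gS b01) => -> _.
  by apply: sinc => //; exact: subset_itv01.
move=> x01 y01; have [xy|yx|->] := ltgtP x y; last by rewrite ltxx.
  exact: mono.
by apply/negbTE; rewrite -leNgt ltW // mono.
Qed.

Lemma generator_comp_decreasing p q : 0 < p -> 0 < q -> (phi p < phi q) = (q < p).
Proof.
move=> /(strict_generator_surj gT)[x x01 <-] /(strict_generator_surj gT)[y y01 <-].
by rewrite !generator_compE // tconorm_generator_increasing //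
  tnorm_generator_decreasing.
Qed.

Lemma generator_comp_surj r : 0 < r -> exists2 p, 0 < p & phi p = r.
Proof.
move=> /(strict_generator_surj gS)[x x01 <-]; exists (fine (t x)).
  by case: (strict_generator_gt0 gT x01).
exact: generator_compE.
Qed.

Lemma generator_comp_gt0 p : 0 < p -> 0 < phi p.
Proof.
move=> /(strict_generator_surj gT)[x x01 <-]; rewrite generator_compE //.
by case: (strict_generator_gt0 gS x01).
Qed.

(** A monotone surjection has no jumps. This is applied on [[p / 2, p * 2]], a compact interval of
    positive reals with [p] in its interior. *)
Lemma generator_comp_continuous : {in ([set` `]0, +oo[] : set R), continuous phi}.
Proof.
move=> p /set_mem; rewrite /= in_itv /= andbT => p0.
apply: (@within_continuous_continuous _ _ _ (p / 2) (p * 2)); [by lra| |].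
  have pos z : z \in `[p / 2, p * 2] -> 0 < z by rewrite in_itv /=; lra.
  apply: segment_dec_surj_continuous.
    move=> x y /pos x0 /pos y0.
    by rewrite leNgt generator_comp_decreasing // -leNgt.
  move=> r; rewrite /= in_itv /= => /andP[r1 r2].
  have r0 : 0 < r by apply: lt_le_trans r1; apply: generator_comp_gt0; lra.
  have [q q0 qr] := generator_comp_surj r0; exists q => //.
  rewrite /= in_itv /= !leNgt -[q < _]generator_comp_decreasing //; last by lra.
  rewrite -[_ < q]generator_comp_decreasing //; last by lra.
  by rewrite qr -!leNgt r1 r2.
by rewrite in_itv /=; lra.
Qed.

(** * Intervals, aggregation functions and admissibility *)

Lemma Int01_lo (u : Int01 R) : lo u \in `[0, 1].
Proof. by case: u => /= a b /and3P[a0 ab b1]; rewrite in_itv /= a0 (le_trans ab). Qed.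

Lemma Int01_hi (u : Int01 R) : hi u \in `[0, 1].
Proof. by case: u => /= a b /and3P[a0 ab b1]; rewrite in_itv /= b1 (le_trans a0). Qed.

Lemma Int01_inj (u v : Int01 R) : lo u = lo v -> hi u = hi v -> u = v.
Proof.
case: u v => [a b abP] [c d cdP] /= ac bd; subst c d.
by rewrite (bool_irrelevance abP cdP).
Qed.

Lemma aggregation_tnorm : aggregation_function (restrict_Int T).
Proof.
case: hT => -[[[T01 TC _ Tl Tr] T1] _ _] _ _.
rewrite /restrict_Int; split=> [u|||u x ux1 ux2] /=.
- by rewrite T01 ?Int01_lo ?Int01_hi.
(* By monotonicity [T 0 0 <= T 0 1 = 0]. *)
- apply/eqP; rewrite eq_le; apply/andP; split.
    by rewrite -[leRHS]T1 ?in01_0 // Tr ?in01_0 ?in01_1.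
  by have := T01 0 0 (in01_0 R) (in01_0 R); rewrite in_itv => /andP[].
- by rewrite T1 // in01_1.
by apply: (@le_trans _ _ (T (lo x) (hi u))); [apply: Tl|apply: Tr];
  rewrite ?Int01_lo ?Int01_hi.
Qed.

Lemma aggregation_tconorm : aggregation_function (restrict_Int S).
Proof.
case: hS => -[[[S01 SC _ Sl Sr] S0] _ _] _ _.
rewrite /restrict_Int; split=> [u|||u x ux1 ux2] /=.
- by rewrite S01 ?Int01_lo ?Int01_hi.
- by rewrite S0 // in01_0.
- apply/eqP; rewrite eq_le; apply/andP; split.
    by have := S01 1 1 (in01_1 R) (in01_1 R); rewrite in_itv => /andP[].
  by rewrite -[leLHS]S0 ?in01_1 // Sr ?in01_0 ?in01_1.
by apply: (@le_trans _ _ (S (lo x) (hi u))); [apply: Sl|apply: Sr];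
  rewrite ?Int01_lo ?Int01_hi.
Qed.

(** The relation is the lexicographic order pulled back along [A] and [B]. Intervals with equal
    values are related both ways, so antisymmetry amounts to injectivity; monotonicity of [A] and
    [B] gives the extension of the interval order. *)
Lemma admissible_pair_injective (A B : Int01 R -> R) :
  admissible_pair A B <->
  [/\ aggregation_function A, aggregation_function B &
      forall u x, A u = A x -> B u = B x -> u = x].
Proof.
split=> [[Aagg Bagg [[[_ anti] _] _]]|[Aagg Bagg inj]]; split=> //.
  by move=> u x AE BE; apply: anti; rewrite /le_pair AE BE eqxx lexx !orbT.
split; last first.
  move=> u x /andP[lux hux]; case: Aagg Bagg => _ _ _ Am [_ _ _ Bm].
  by rewrite /le_pair Bm // andbT orbC -le_eqVlt Am.
split; [split; [split|]|].
- by move=> u; rewrite /le_pair eqxx lexx orbT.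
- move=> x u y; rewrite /le_pair.
  case/orP=> [ux|/andP[/eqP -> ux]]; case/orP=> [xy|/andP[/eqP <- xy]].
  + by rewrite (lt_trans ux).
  + by rewrite ux.
  + by rewrite xy.
  + by rewrite eqxx (le_trans ux) ?orbT.
- move=> u x /andP[]; rewrite /le_pair; case: ltgtP => //= AE BE1 BE2.
  by apply: inj => //; apply: le_anti; rewrite BE1.
by move=> u x; rewrite /le_pair; case: ltgtP => //= _; exact: le_total.
Qed.

(** * Injectivity on intervals versus convexity or concavity of [phi] *)

Lemma tnorm_tconorm_injective :
  strictly_convex_on `]0, +oo[ phi \/ strictly_concave_on `]0, +oo[ phi ->
  forall u x : Int01 R, restrict_Int T u = restrict_Int T x ->
    restrict_Int S u = restrict_Int S x -> u = x.
Proof.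
move=> phiP u x; rewrite /restrict_Int.
have [lou hiu lox hix] := And4 (Int01_lo u) (Int01_hi u) (Int01_lo x) (Int01_hi x).
move=> /(strict_generator_eq gT lou hiu lox hix) tE.
move=> /(strict_generator_eq gS lou hiu lox hix) sE.
have lohi (v : Int01 R) : lo v <= hi v by case: v => /= a b /and3P[].
(* An infinite sum of [t] forces an endpoint 0, hence a lower endpoint 0. Dually, an infinite sum of
   [s] detects an upper endpoint 1. *)
have lo0 (v : Int01 R) : (t (lo v) + t (hi v))%E = +oo%E <-> lo v = 0.
  rewrite (strict_generator_addy gT (Int01_lo v) (Int01_hi v)).
  split=> [[//|v0]|]; last by left.
  apply/eqP; rewrite eq_le -{1}v0 lohi /=.
  by have := Int01_lo v; rewrite in_itv => /andP[].
have hi1 (v : Int01 R) : (s (lo v) + s (hi v))%E = +oo%E <-> hi v = 1.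
  rewrite (strict_generator_addy gS (Int01_lo v) (Int01_hi v)).
  split=> [[v1|//]|]; last by right.
  apply/eqP; rewrite eq_le -{2}v1 lohi andbT.
  by have := Int01_hi v; rewrite in_itv => /andP[].
(* Both lower endpoints are then 0, where [s] vanishes, so the equality of [s]-sums gives the upper
   ones. The next case is dual, with [t 1 = 0]. *)
have [lou0|lou0] := eqVneq (lo u) 0.
  have lox0 : lo x = 0 by apply/lo0; rewrite -tE; apply/lo0.
  apply: Int01_inj; first by rewrite lou0.
  case: gS sE => _ [s0 _] sinj _ _; rewrite lou0 lox0 s0 !add0e; exact: sinj.
have [hiu1|hiu1] := eqVneq (hi u) 1.
  have hix1 : hi x = 1 by apply/hi1; rewrite -sE; apply/hi1.
  apply: Int01_inj; last by rewrite hiu1.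
  case: gT tE => _ [t1 _] tinj _ _; rewrite hiu1 hix1 t1 !adde0; exact: tinj.
have oo (v : Int01 R) : lo v != 0 -> hi v != 1 ->
    (lo v \in `]0, 1[) * (hi v \in `]0, 1[).
  move=> v0 v1; rewrite !(in01_oo gS) Int01_lo Int01_hi v0 v1 /= andbT.
  have := Int01_lo v; have := Int01_hi v; have := lohi v; rewrite !in_itv /=.
  move=> vv /andP[_ hv1] /andP[lv0 _]; split.
    by apply: contra_neq v1 => lv1; apply: le_anti; rewrite hv1 -lv1 vv.
  by apply: contra_neq v0 => hv0; apply: le_anti; rewrite lv0 -hv0 vv.
have [lou' hiu'] := oo _ lou0 hiu1.
have [||lox' hix'] := oo x.
- by apply: contra_neq lou0 => /lo0 x0; apply/lo0; rewrite tE.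
- by apply: contra_neq hiu1 => /hi1 x1; apply/hi1; rewrite sE.
have pos y : y \in `]0, 1[ -> [set` `]0, +oo[] (fine (t y)).
  by move=> /(strict_generator_gt0 gT)[_]; rewrite /= in_itv /= andbT.
have ge (v : Int01 R) : lo v \in `]0, 1[ -> hi v \in `]0, 1[ ->
    fine (t (hi v)) <= fine (t (lo v)).
  by move=> l h; rewrite leNgt tnorm_generator_decreasing // -leNgt.
have tfin y : y \in `]0, 1[ -> t y = (fine (t y))%:E.
  by move=> /(strict_generator_gt0 gT)[].
have sfin y : y \in `]0, 1[ -> s y = (fine (s y))%:E.
  by move=> /(strict_generator_gt0 gS)[].
move: tE; rewrite (tfin _ lou') (tfin _ hiu') (tfin _ lox') (tfin _ hix') => -[tE].
move: sE; rewrite (sfin _ lou') (sfin _ hiu') (sfin _ lox') (sfin _ hix') => -[sE].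
(* Since [t] decreases, the lower endpoint has the larger coordinate; this is the ordering that
   [majorized_sum_inj] requires. *)
have tlo : fine (t (lo u)) = fine (t (lo x)).
  apply: (majorized_sum_inj phiP) tE _; rewrite ?generator_compE //;
    by [exact: pos|exact: ge].
have thi : fine (t (hi u)) = fine (t (hi x)) by move: tE; rewrite tlo => /addrI.
by apply: Int01_inj; apply: (strict_generator_inj gT) => //;
  rewrite tfin // [RHS]tfin // ?tlo ?thi.
Qed.

Lemma tnorm_tconorm_convex_or_concave :
  (forall u x : Int01 R, restrict_Int T u = restrict_Int T x ->
    restrict_Int S u = restrict_Int S x -> u = x) ->
  strictly_convex_on `]0, +oo[ phi \/ strictly_concave_on `]0, +oo[ phi.
Proof.
move=> inj; apply: midpoint_convex_or_concave.
- exact: interval_is_interval.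
- exact: generator_comp_continuous.
move=> a b; rewrite /= !in_itv /= !andbT => a0 b0 ab; apply/eqP => phiE.
have c0 : 0 < (a + b) / 2 by lra.
(* The larger value [b] yields the smaller point [x], again because [t] decreases. *)
have [x x01 tx] := strict_generator_surj gT b0.
have [y y01 ty] := strict_generator_surj gT a0.
have [z z01 tz] := strict_generator_surj gT c0.
have xy : x < y by rewrite -tnorm_generator_decreasing // tx ty.
have intP (p q : R) : p \in `]0, 1[ -> q \in `]0, 1[ -> p <= q ->
    [&& 0 <= p, p <= q & q <= 1].
  by rewrite !in_itv /= => /andP[/ltW -> _] /andP[_ /ltW ->] ->.
pose u := MkInt01 (intP x y x01 y01 (ltW xy)).
(* The [t]-sums of [u] and [w] agree since [t z] is the mean of [a] and [b], and the [s]-sums agree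
   by [phiE]. Yet [u = w] would give [x = y]. *)
pose w := MkInt01 (intP z z z01 z01 (lexx z)).
have [xc yc zc] := And3 (subset_itv01 x01) (subset_itv01 y01) (subset_itv01 z01).
suff uw : u = w.
  have /= xz := congr1 (@lo R) uw; have /= yz := congr1 (@hi R) uw.
  by have := xy; rewrite xz yz ltxx.
apply: inj; rewrite /restrict_Int /=.
  apply/(strict_generator_eq gT) => //.
  have [[<- _] [<- _]] := (strict_generator_gt0 gT x01, strict_generator_gt0 gT y01).
  have [<- _] := strict_generator_gt0 gT z01.
  by rewrite tx ty tz -!EFinD; congr EFin; field.
apply/(strict_generator_eq gS) => //.
have [[<- _] [<- _]] := (strict_generator_gt0 gS x01, strict_generator_gt0 gS y01).
have [<- _] := strict_generator_gt0 gS z01.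
rewrite -!generator_compE // tx ty tz -!EFinD; congr EFin; lra.
Qed.

End Main.

Theorem theorem4p10 (R : realType) (T S : R -> R -> R) (t s : R -> \bar R)
  (hT : strict_tnorm T t) (hS : strict_tconorm S s) :
  admissible_pair (restrict_Int T) (restrict_Int S) <->
  strictly_convex_on `]0, +oo[ (generator_comp s t) \/
  strictly_concave_on `]0, +oo[ (generator_comp s t).
Proof.
split=> [/admissible_pair_injective[_ _]|phiP].
  exact: tnorm_tconorm_convex_or_concave hT hS.
apply/admissible_pair_injective; split.
- exact: aggregation_tnorm hT.
- exact: aggregation_tconorm hS.
exact: tnorm_tconorm_injective hT hS phiP.
Qed.
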